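(* Let $((G(n))_{n\in\mathbb{N}},(i_{n_1,n_2})_{n_1\mid n_2})$ and $((A(n))_{n\in\mathbb{N}},(j_{n_1,n_2})_{n_1\mid n_2})$ be surjective inverse systems of finite groups ordered by the divisibility relation on $\mathbb{N}$, with transition maps $i_{n_1,n_2}:G(n_2)\to G(n_1)$ and $j_{n_1,n_2}:A(n_2)\to A(n_1)$ for $n_1\mid n_2$. Assume that for each $n\ge1$ there is an injective group homomorphism $r_n:G(n)\to A(n)$ such that $j_{n_1,n_2}\circ r_{n_2}=r_{n_1}\circ i_{n_1,n_2}$ whenever $n_1\mid n_2$. Let $r:G=\varprojlim G(n)\to A=\varprojlim A(n)$ be the resulting injective continuous homomorphism of profinite groups. Let $m$ be a fixed positive integer and let $\mu_m$ be the multiplicative group of $m$-th roots of unity. Suppose there exists an exact sequence $$1\to G\stackrel{r}{\longrightarrow}A\stackrel{\chi}{\longrightarrow}\mu_m\to1,$$ where $\chi$ is a continuous homomorphism. Let $g$ be an arithmetic function such that $$\sum_{n\ge1}\frac{|g(n)|}{\#G(n)}<\infty.$$ Let $\pi_{A,n}:A\to A(n)$ be the natural projections and let $$\tilde g=\sum_{n\ge1}g(n)\,1_{\ker\pi_{A,n}}.$$ Let $\nu_A$ be the normalized Haar measure on $A$. Then $\tilde g\in L^1(\nu_A)$ and $$\sum_{n\ge1}\frac{g(n)}{\#G(n)}=\sum_{i=0}^{m-1}\int_A\tilde g\,\chi^i\,d\nu_A.$$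
   Context: An inverse system is surjective if all its transition maps are surjective. $1_S$ denotes the characteristic function of a set $S$. An arithmetic function is a complex-valued function on the positive integers. $\mu_m$ is regarded as the group of complex $m$-th roots of unity. The normalized Haar measure on a profinite (compact) group is the Haar measure of total mass $1$, and $L^1(\nu_A)$ is the space of $\nu_A$-integrable functions (the series defining $\tilde g$ being considered $\nu_A$-almost everywhere). *)

(* Defs.v *)
From HB Require Import structures.
From mathcomp Require Import all_boot all_order all_algebra all_fingroup.
From mathcomp Require Import complex.
From mathcomp Require Import all_classical all_reals all_analysis.

Set Implicit Arguments.
Unset Strict Implicit.
Unset Printing Implicit Defensive.

Import Order.TTheory GRing.Theory Num.Theory.
Import numFieldTopology.Exports.

Local Open Scope classical_set_scope.
Local Open Scope ring_scope.

(* The indices are the positive integers only: 0 would be a greatest element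
   for divisibility and would change every inverse limit. *)
Definition posnat := {n : nat | (0 < n)%N}.

Definition pos (k : nat) : posnat := exist _ k.+1 isT.

(* For groups, {multiplicative _ -> _} is the type of group homomorphisms. *)
Record invsystem := InvSystem {
  obj :> posnat -> finGroupType;
  trans : forall n1 n2 : posnat, (val n1 %| val n2)%N ->
    {multiplicative obj n2 -> obj n1};
  trans_id : forall (n : posnat) (h : (val n %| val n)%N) (x : obj n),
    trans h x = x;
  trans_comp : forall (n1 n2 n3 : posnat) (h12 : (val n1 %| val n2)%N)
    (h23 : (val n2 %| val n3)%N) (h13 : (val n1 %| val n3)%N) (x : obj n3),
    trans h12 (trans h23 x) = trans h13 x
}.
Arguments trans {_ n1 n2} h.

Definition surjective_system (S : invsystem) : Prop :=
  forall (n1 n2 : posnat) (h : (val n1 %| val n2)%N) (y : S n1),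
    exists x : S n2, trans h x = y.

Record invlim (S : invsystem) := InvLim {
  invlim_proj : forall n : posnat, S n;
  invlim_projP : forall (n1 n2 : posnat) (h : (val n1 %| val n2)%N),
    trans h (invlim_proj n2) = invlim_proj n1
}.
Arguments invlim_proj {S} _ n.

Lemma invlimP (S : invsystem) (x y : invlim S) :
  (forall n, invlim_proj x n = invlim_proj y n) -> x = y.
Proof.
case: x y => [x xP] [y yP] /= xy.
have {}xy : x = y by exact: functional_extensionality_dep.
by case: y / xy yP => yP; congr InvLim; exact: Prop_irrelevance.
Qed.

Section invlim_group.
Variable S : invsystem.
Local Open Scope group_scope.

Definition invlim_one : invlim S.
Proof.
by exists (fun n => 1) => n1 n2 h; apply: (@mulgI _ (trans h 1));
  rewrite -gmulfM !mulg1.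
Defined.

Definition invlim_mul (x y : invlim S) : invlim S.
Proof.
by exists (fun n => invlim_proj x n * invlim_proj y n) => n1 n2 h;
  rewrite gmulfM !invlim_projP.
Defined.

Definition invlim_inv (x : invlim S) : invlim S.
Proof.
exists (fun n => (invlim_proj x n)^-1) => n1 n2 h.
apply: (@mulgI _ (trans h (invlim_proj x n2))).
by rewrite -gmulfM mulgV [in RHS]invlim_projP mulgV (invlim_projP invlim_one h).
Defined.

Lemma invlim_mulA : associative invlim_mul.
Proof. by move=> x y z; apply: invlimP => n /=; rewrite mulgA. Qed.

Lemma invlim_mul1 : left_id invlim_one invlim_mul.
Proof. by move=> x; apply: invlimP => n /=; rewrite mul1g. Qed.

Lemma invlim_mulr1 : right_id invlim_one invlim_mul.
Proof. by move=> x; apply: invlimP => n /=; rewrite mulg1. Qed.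

Lemma invlim_mulV : left_inverse invlim_one invlim_inv invlim_mul.
Proof. by move=> x; apply: invlimP => n /=; rewrite mulVg. Qed.

Lemma invlim_mulrV : right_inverse invlim_one invlim_inv invlim_mul.
Proof. by move=> x; apply: invlimP => n /=; rewrite mulgV. Qed.

HB.instance Definition _ := gen_eqMixin (invlim S).
HB.instance Definition _ := gen_choiceMixin (invlim S).
HB.instance Definition _ := isPointed.Build (invlim S) invlim_one.
HB.instance Definition _ := isGroup.Build (invlim S)
  invlim_mulA invlim_mul1 invlim_mulr1 invlim_mulV invlim_mulrV.

End invlim_group.

(* The profinite topology is the subspace topology of the product of the
   discrete spaces S n. *)
Definition invlim_prod (S : invsystem) (x : invlim S) :
  prod_topology (fun n => discrete_topology (S n)) := invlim_proj x.

HB.instance Definition _ (S : invsystem) :=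
  Topological.copy (invlim S) (initial_topology (@invlim_prod S)).

Lemma invlim_proj_continuous (S : invsystem) (n : posnat) :
  continuous ((fun x => invlim_proj x n) : invlim S -> discrete_topology (S n)).
Proof.
move=> x; apply: (@continuous_comp _ _ _ (@invlim_prod S)
  (fun f => @mathcomp_extra.proj _ (fun n => discrete_topology (S n)) n f)).
  exact: initial_continuous.
exact: (@proj_continuous _ (fun n => discrete_topology (S n)) n).
Qed.

Definition proj_ker (S : invsystem) (n : posnat) : set (invlim S) :=
  [set x | invlim_proj x n = 1%g].
Arguments proj_ker : clear implicits.

Section limit_map.
Variables (G A : invsystem) (r : forall n, {multiplicative G n -> A n}).

Definition compatible : Prop :=
  forall (n1 n2 : posnat) (h : (val n1 %| val n2)%N) (x : G n2),
    trans h (r n2 x) = r n1 (trans h x).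

Hypothesis rP : compatible.

Definition limit_map (x : invlim G) : invlim A.
Proof.
by exists (fun n => r n (invlim_proj x n)) => n1 n2 h; rewrite rP invlim_projP.
Defined.

Lemma limit_mapM x y :
  limit_map (x * y)%g = (limit_map x * limit_map y)%g.
Proof. by apply: invlimP => n /=; rewrite gmulfM. Qed.

Lemma limit_map_inj : (forall n, injective (r n)) -> injective limit_map.
Proof.
move=> ri x y /(congr1 (@invlim_proj A)) xy; apply: invlimP => n.
by apply: (ri n); exact: (congr1 (fun f => f n) xy).
Qed.

Lemma limit_map_continuous : continuous limit_map.
Proof.
apply: continuous_comp_initial => x.
apply/cvg_sup; first exact/fmap_filter/nbhs_filter.
move=> n; move: x.
apply: (@continuous_comp_initial _ _ _
  (fun f : prod_topology (fun n => discrete_topology (A n)) => f n)) => x.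
apply: (@continuous_comp _ _ _
  (fun x => invlim_proj x n : discrete_topology (G n))
  (r n : discrete_topology (G n) -> discrete_topology (A n))).
  exact: invlim_proj_continuous.
by move=> U /= /nbhs_singleton Ux; apply: filterS (discrete_set1 _) => y ->.
Qed.

End limit_map.

Definition borelType (S : invsystem) := g_sigma_algebraType (@open (invlim S)).

(* Regularity, often part of the definition of a Haar measure, is automatic
   here: the index set is countable, so invlim S is a compact metrizable space
   and every finite Borel measure on it is regular. *)
Definition normalized_haar (R : realType) (S : invsystem)
    (nu : probability (borelType S) R) : Prop :=
  forall (a : invlim S) (E : set (borelType S)), measurable E ->
    nu [set (a * x)%g | x in (E : set (invlim S))] = nu E.

Section complex_integral.
Context {d : measure_display} {T : measurableType d} {R : realType}.
Variable mu : {measure set T -> \bar R}.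

Definition cintegrable (f : T -> R[i]) : Prop :=
  mu.-integrable setT (fun x => (complex.Re (f x))%:E) /\
  mu.-integrable setT (fun x => (complex.Im (f x))%:E).

Definition cintegral (f : T -> R[i]) : R[i] :=
  Complex (Rintegral mu setT (fun x => complex.Re (f x)))
          (Rintegral mu setT (fun x => complex.Im (f x))).

End complex_integral.

(* The exponent ^o gives R[i] the topology of its modulus. *)
Definition gtilde_series (R : realType) (A : invsystem) (g : posnat -> R[i])
    (a : invlim A) : R[i]^o ^nat :=
  series (fun k => g (pos k) * \1_(proj_ker A (pos k)) a).

(* The value is unspecified where the series diverges. *)
Definition gtilde (R : realType) (A : invsystem) (g : posnat -> R[i])
    (a : invlim A) : R[i] := limn (gtilde_series g a).

(* Exactness of 1 -> G -r-> A -chi-> mu_m -> 1, with mu_m seen in R[i]. *)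
Definition short_exact (R : realType) (G A : invsystem) (m : nat)
    (r : invlim G -> invlim A) (chi : invlim A -> R[i]) : Prop :=
  [/\ injective r,
      range r = [set a | chi a = 1]
    & range chi = [set z | m.-unity_root z]].

(* Main.v *)
Require Import Defs.
From mathcomp Require Import all_boot all_order all_algebra all_fingroup.
From mathcomp Require Import complex separable cyclotomic.
From mathcomp Require Import all_classical all_reals all_analysis.
From mathcomp Require Import measurable_realfun.

Set Implicit Arguments.
Unset Strict Implicit.
Unset Printing Implicit Defensive.

Import Order.TTheory GRing.Theory Num.Theory.
Import numFieldTopology.Exports.

Local Open Scope classical_set_scope.
Local Open Scope ring_scope.

(** The theorem is orthogonality of characters on mu_m, integrated term by term
    against the absolutely summable series defining gtilde.

    Fix n and write K_n for the kernel of the projection A -> A(n).  For a in A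
    the number chi a is an m-th root of unity, so the sum of chi a ^+ i over
    i < m is m if chi a = 1 and 0 otherwise ([sum_unity_root]).  Hence the sum
    over i of the integrals of 1_{K_n} chi^i is m times the Haar measure of
    K_n `&` ker chi.  By exactness ker chi is the image of G; since r_n is
    injective, K_n `&` ker chi is the image of the kernel of G -> G(n), which
    has index #G(n) in G, and G has index m in A because there are exactly m
    roots of unity in R[i].  So K_n `&` ker chi has measure 1 / (m #G(n))
    ([haar_proj_ker_exact]), and the m integrals add up to 1 / #G(n).

    Indices turn into measures by [haar_transversal]: if the translates of a
    measurable set N by a finite family partition A, then translation
    invariance forces nu N to be the inverse of the size of the family.
    Building such families needs preimages in A and G of all elements of A(n)
    and G(n), which is where surjectivity of the systems enters
    ([invlim_proj_surj]).

    To exchange the sum and the integrals, note that K_n has measure 1 / #A(n)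
    ([haar_proj_ker]), and #G(n) <= #A(n) since r_n is injective.  So the sum of
    |g n| nu K_n is finite, the function sum |g n| 1_{K_n} is integrable, hence
    finite almost everywhere, and it dominates every partial sum of gtilde times
    a function of modulus at most 1.  Dominated convergence then gives all three
    claims ([indic_series_cvg], [cintegral_indic_series]).  *)

(** * Projections of a surjective inverse limit *)

Section projections_surjective.
Variables (S : invsystem) (S_surj : surjective_system S).
Variables (n : posnat) (y : S n).

Definition mul_pos (p q : posnat) : posnat :=
  exist _ (val p * val q)%N
    (etrans (muln_gt0 _ _) (introT andP (conj (valP p) (valP q)))).

(** The sequence n * k! is increasing for divisibility and is divisible by any
    given d from some rank on.  An element of the limit is therefore known from
    compatible values along this sequence alone, and such values can be lifted
    one step at a time. *)
Fixpoint chain (k : nat) : posnat :=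
  if k is k'.+1 then mul_pos (chain k') (pos k') else n.

Lemma chainS k : (val (chain k) %| val (chain k.+1))%N.
Proof. exact: dvdn_mulr. Qed.

Lemma chain_le k l : (k <= l)%N -> (val (chain k) %| val (chain l))%N.
Proof.
elim: l => [|l IH]; first by rewrite leqn0 => /eqP->.
rewrite leq_eqVlt ltnS => /orP[/eqP-> //|/IH kl].
exact: dvdn_trans kl (chainS l).
Qed.

(** d divides d!, so the rank d itself is late enough in the chain. *)
Lemma dvdn_chain (d : posnat) : (val d %| val (chain (val d)))%N.
Proof. by case: d => [[//|d] d0] /=; exact: dvdn_mull. Qed.

Fixpoint lift_chain (k : nat) : S (chain k) :=
  if k is k'.+1 then sval (cid (S_surj (chainS k') (lift_chain k'))) else y.

Lemma lift_chainP k l (h : (val (chain k) %| val (chain l))%N) :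
  (k <= l)%N -> trans h (lift_chain l) = lift_chain k.
Proof.
elim: l h => [|l IH] h.
  by rewrite leqn0 => /eqP E; subst k; exact: trans_id.
rewrite leq_eqVlt ltnS => /orP[/eqP E|kl]; first by subst k; exact: trans_id.
rewrite -(trans_comp (chain_le kl) (chainS l) h).
by rewrite [lift_chain l.+1]/=;
  rewrite (svalP (cid (S_surj (chainS l) (lift_chain l)))) IH.
Qed.

(** The d-th component of the limit is read off at rank d of the chain; a later
    rank would give the same value, which is what makes two components read at
    different ranks compatible. *)
Lemma lift_chain_compat (n1 n2 : posnat) (h : (val n1 %| val n2)%N) :
  trans h (trans (dvdn_chain n2) (lift_chain (val n2))) =
  trans (dvdn_chain n1) (lift_chain (val n1)).
Proof.
have le12 : (val n1 <= val n2)%N by exact: dvdn_leq (valP n2) h.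
have h1 := dvdn_trans h (dvdn_chain n2).
rewrite (trans_comp h (dvdn_chain n2) h1).
by rewrite -(trans_comp (dvdn_chain n1) (chain_le le12) h1) lift_chainP.
Qed.

(** The components read off the chain lie over y, because the chain starts at n
    and every lift in it restricts to y. *)
Lemma invlim_proj_surj : exists x : invlim S, invlim_proj x n = y.
Proof.
exists (InvLim lift_chain_compat) => /=.
exact: (@lift_chainP 0).
Qed.

End projections_surjective.

(** * Haar measure and finite partitions into translates *)

Section borel_sets.
Variable A : invsystem.

Lemma measurable_open (U : set (invlim A)) :
  open U -> measurable (U : set (borelType A)).
Proof. by move=> oU; exact: sub_gen_smallest. Qed.

Lemma measurable_proj_ker (n : posnat) :
  measurable (proj_ker A n : set (borelType A)).
Proof.
apply: measurable_open.
have /continuousP/(_ [set (1%g : A n)]) := @invlim_proj_continuous A n.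
by apply; exact: discrete_open.
Qed.

Lemma continuous_measurable_invlim (R : realType) (f : invlim A -> R) :
  continuous f -> measurable_fun [set: borelType A] (f : borelType A -> R).
Proof.
move=> /continuousP fc; apply: (measurability (@RGenOpens.G R)).
  exact: RGenOpens.measurableE.
move=> _ [_ [a [b ->] <-]]; rewrite setTI; apply: measurable_open.
by apply: fc; exact: interval_open.
Qed.

(** In each coordinate, translation by a is a map between discrete spaces. *)
Lemma translation_continuous (a : invlim A) :
  continuous (fun x : invlim A => (a * x)%g).
Proof.
apply: continuous_comp_initial => x.
apply/cvg_sup; first exact/fmap_filter/nbhs_filter.
move=> n; move: x.
apply: (@continuous_comp_initial _ _ _
  (fun f : prod_topology (fun n => discrete_topology (A n)) => f n)) => x.
apply: (@continuous_comp _ _ _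
  (fun x => invlim_proj x n : discrete_topology (A n))
  ((fun y => invlim_proj a n * y)%g :
     discrete_topology (A n) -> discrete_topology (A n))).
  exact: invlim_proj_continuous.
by move=> U /= /nbhs_singleton Ux; apply: filterS (discrete_set1 _) => y ->.
Qed.

Lemma measurable_translate (a : invlim A) (E : set (invlim A)) :
  measurable (E : set (borelType A)) ->
  measurable [set x : borelType A | E (a * x)%g].
Proof.
move=> mE; rewrite -[X in measurable X]setTI.
have : measurable_fun setT
    ((fun x : invlim A => (a * x)%g) : borelType A -> borelType A).
  apply: (@measurability _ _ (borelType A) (borelType A) setT _
    (@open (invlim A))) => //.
  move=> _ [U oU <-]; rewrite setTI; apply: measurable_open.
  by have /continuousP := @translation_continuous a; apply.
by apply.
Qed.

End borel_sets.

Section haar.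
Variables (R : realType) (A : invsystem) (nu : probability (borelType A) R).
Hypothesis nu_haar : normalized_haar nu.

Lemma haar_translate (a : invlim A) (E : set (invlim A)) :
  measurable (E : set (borelType A)) ->
  nu [set x : borelType A | E (a^-1 * x)%g] = nu (E : set (borelType A)).
Proof.
move=> mE; rewrite -[RHS](nu_haar a mE); congr (nu _).
apply/seteqP; split=> x /=.
  by move=> Ex; exists (a^-1 * x)%g => //; rewrite mulKVg.
by move=> [z Ez <-]; rewrite mulKg.
Qed.

(** The fibres of c are the translates of N by the elements a t.  They partition
    the group and all have the measure of N, so #|T| times that measure is 1. *)
Lemma haar_transversal (T : finType) (a : T -> invlim A) (c : invlim A -> T)
    (N : set (invlim A)) :
  measurable (N : set (borelType A)) ->
  (forall x t, N ((a t)^-1 * x)%g <-> c x = t) ->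
  nu (N : set (borelType A)) = (#|T|%:R^-1)%:E.
Proof.
move=> mN Nc.
pose F t := [set x : borelType A | N ((a t)^-1 * x)%g].
have mF t : measurable (F t) by exact: measurable_translate.
have : nu (\bigcup_(t in [set: T]) F t) = 1%E.
  rewrite -(@probability_setT _ _ _ nu); congr (nu _).
  by apply/seteqP; split=> x // _; exists (c x) => //; apply/Nc.
rewrite measure_fin_bigcup //=; last first.
  by move=> s t _ _ [x [/Nc <- /Nc]].
have finN : nu (N : set (borelType A)) \is a fin_num by exact: fin_num_measure.
rewrite (@fsbigE _ _ _ _ _ (enum T)) ?enum_uniq //=; last first.
  by move=> t _; rewrite mem_enum.
rewrite (eq_bigr (fun=> nu (N : set (borelType A)))); last first.
  by move=> t _; rewrite [LHS]haar_translate.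
rewrite big_enum_cond /=.
rewrite (eq_bigl predT) => [|t]; last by rewrite in_setT.
rewrite -(fineK finN) sumEFin sumr_const => -[E'].
have {E'}E : fine (nu (N : set (borelType A))) * #|T|%:R = 1.
  by rewrite mulr_natr.
have T0 : #|T|%:R != 0 :> R.
  by apply/eqP => T0; move/eqP: E; rewrite T0 mulr0 eq_sym oner_eq0.
by congr (_%:E); rewrite -[LHS](mulfK T0) E div1r.
Qed.

End haar.

(** * Measures of the kernels *)

(** 'X^m - 1 is separable as m is invertible, and splits since the field is
    closed. *)
Lemma unity_roots_enum (F : closedFieldType) (m : nat) :
  (0 < m)%N -> m%:R != 0 :> F ->
  exists w : m.-tuple F, uniq w /\ forall z, (z \in w) = m.-unity_root z.
Proof.
move=> m_gt0 m0.
have [rs Ers] := closed_field_poly_normal ('X^m - 1 : {poly F}).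
rewrite lead_coefXnsubC // scale1r in Ers.
have := separable_Xn_sub_1 m0; rewrite Ers separable_prod_XsubC => urs.
have/eqP := size_XnsubC (1 : F) m_gt0; rewrite Ers size_prod_XsubC eqSS => srs.
exists (Tuple srs); split=> // z.
by rewrite /root_of_unity /= Ers root_prod_XsubC.
Qed.

(** Orthogonality on mu_m: if z != 1, the geometric sum is killed by z - 1. *)
Lemma sum_unity_root (F : fieldType) (m : nat) (z : F) : z ^+ m = 1 ->
  \sum_(i < m) z ^+ i = m%:R * (z == 1)%:R.
Proof.
move=> zm; have [->|z1] := eqVneq z 1.
  by under eq_bigr do rewrite expr1n; rewrite sumr_const card_ord mulr1.
rewrite mulr0; apply: (mulfI (x := z - 1)); first by rewrite subr_eq0.
by rewrite mulr0 -subrX1 zm subrr.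
Qed.

Section kernels.
Variables (R : realType) (G A : invsystem).
Hypotheses (G_surj : surjective_system G) (A_surj : surjective_system A).
Variables (nu : probability (borelType A) R).
Hypothesis nu_haar : normalized_haar nu.

(** The cosets of the kernel are indexed by A n, through the projection. *)
Lemma haar_proj_ker (n : posnat) :
  nu (proj_ker A n : set (borelType A)) = (#|A n|%:R^-1)%:E.
Proof.
have [a aP] := choice (invlim_proj_surj A_surj (n := n)).
apply: (haar_transversal nu_haar (a := a) (c := fun x => invlim_proj x n)).
  exact: measurable_proj_ker.
move=> x y; rewrite /proj_ker /= aP; split=> [|->]; last exact: mulVg.
by move=> /(congr1 (mulg y)); rewrite mulKVg mulg1.
Qed.

Variables (rn : forall n : posnat, {multiplicative G n -> A n}).
Hypothesis (rn_inj : forall n : posnat, injective (rn n)).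
Variables (rn_compat : compatible rn) (m : nat) (m_gt0 : (0 < m)%N).
Variables (chi : invlim A -> R[i]).
Hypothesis (chiM : forall a b : invlim A, chi (a * b)%g = chi a * chi b).
Hypothesis (exact_seq : short_exact m (limit_map rn_compat) chi).
Hypothesis (mchi : measurable ([set a | chi a = 1] : set (borelType A))).

(** The cosets are indexed by 'I_m * G n: chi x selects the coset of ker chi,
    and what remains of x is the image of an element of the limit of G, whose
    n-th component selects the coset inside ker chi.  Injectivity of [rn n]
    ensures that this component can be recovered from the n-th one in A. *)
Lemma haar_proj_ker_exact (n : posnat) :
  nu ((proj_ker A n `&` [set a | chi a = 1]) : set (borelType A)) =
  ((m * #|G n|)%:R^-1)%:E.
Proof.
have [r_inj r_range chi_range] := exact_seq.
have m0 : m%:R != 0 :> R[i] by rewrite pnatr_eq0 -lt0n.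
have [w [w_uniq wE]] := unity_roots_enum m_gt0 m0.
have chi_neq0 a : chi a != 0.
  have : range chi (chi a) by exists a.
  rewrite chi_range => /unity_rootP cam; apply/eqP => ca0; move: cam.
  by rewrite ca0 expr0n eqn0Ngt m_gt0 => /esym/eqP; rewrite oner_eq0.
have chiV a b : chi (a^-1 * b)%g = (chi a)^-1 * chi b.
  by apply: (mulfI (chi_neq0 a)); rewrite mulVKf // -chiM mulKVg.
have /choice[i_ iP] : forall a : invlim A, exists i, tnth w i = chi a.
  move=> a; have : range chi (chi a) by exists a.
  by rewrite chi_range /= -wE => /tnthP[i ->]; exists i.
(* b i represents the coset of ker chi on which chi takes its i-th value. *)
have /choice[b bP] : forall i, exists b, chi b = tnth w i.
  move=> i; have : range chi (tnth w i).
    by rewrite chi_range /= -wE mem_tnth.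
  by case=> b _ <-; exists b.
have chi_r x : chi (limit_map rn_compat x) = 1.
  suff : [set a | chi a = 1] (limit_map rn_compat x) by [].
  by rewrite -r_range; exists x.
(* q x is the preimage in G of x moved into ker chi. *)
have /choice[q qP] : forall x : invlim A,
    exists u, limit_map rn_compat u = ((b (i_ x))^-1 * x)%g.
  move=> x.
  have : [set a | chi a = 1] ((b (i_ x))^-1 * x)%g.
    by rewrite /= chiV bP iP mulVf.
  by rewrite -r_range => -[u _ <-]; exists u.
have [y yP] := choice (invlim_proj_surj G_surj (n := n)).
pose a (t : 'I_m * G n) := (b t.1 * limit_map rn_compat (y t.2))%g.
have -> : (m * #|G n|)%N = #|{: 'I_m * G n}| by rewrite card_prod card_ord.
apply: (haar_transversal nu_haar (a := a)
  (c := fun x => (i_ x, invlim_proj (q x) n))).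
  by apply: measurableI mchi; exact: measurable_proj_ker.
move=> x [i z].
have chi_a : chi ((a (i, z))^-1 * x)%g = (tnth w i)^-1 * chi x.
  by rewrite chiV /a chiM chi_r mulr1 bP.
have proj_a : i_ x = i -> invlim_proj ((a (i, z))^-1 * x)%g n =
    ((rn n z)^-1 * rn n (invlim_proj (q x) n))%g.
  move=> <-.
  rewrite -[rn n (invlim_proj _ n)]/(invlim_proj (limit_map rn_compat _) n).
  by rewrite qP /a /= yP invgM mulgA.
have w0 : tnth w i != 0 by rewrite -bP chi_neq0.
split=> [[]|[ix zx]].
  rewrite /proj_ker /= => projx; rewrite chi_a => chix.
  have ix : i_ x = i.
    by apply: (tuple_uniqP w w_uniq); rewrite iP -[LHS](mulVKf w0) chix mulr1.
  congr pair => //; apply: rn_inj; apply: (mulgI (rn n z)^-1)%g.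
  by rewrite -proj_a // mulVg; exact: projx.
split; last by rewrite /= chi_a -iP ix mulVf.
by rewrite /proj_ker /mkset proj_a // zx mulVg.
Qed.

End kernels.

(** * Limits and measurability of complex functions *)

Section complex_limits.
Variable R : realType.
Local Notation normc := (@ComplexField.Normc.normc R).

Lemma ReM (a b : R[i]) : complex.Re (a * b) =
  complex.Re a * complex.Re b - complex.Im a * complex.Im b.
Proof. by case: a b => [a a'] [b b']. Qed.

Lemma ImM (a b : R[i]) : complex.Im (a * b) =
  complex.Re a * complex.Im b + complex.Im a * complex.Re b.
Proof. by case: a b => [a a'] [b b']. Qed.

Lemma normc_le_ReIm (z : R[i]) :
  `|z| <= (`|complex.Re z| + `|complex.Im z|)%:C%C.
Proof.
have norm_real (r : R) : `|r%:C%C| = `|r|%:C%C.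
  by rewrite normc_def /= expr0n addr0 sqrtr_sqr.
rewrite {1}(complexE z) (le_trans (ler_normD _ _))// rmorphD lerD ?norm_real//.
by rewrite normrM norm_real normc_def /= expr0n expr1n add0r sqrtr1 mul1r.
Qed.

Lemma normc_ge_Im (z : R[i]) : `|complex.Im z|%:C%C <= `|z|.
Proof.
by rewrite normc_def lecR -sqrtr_sqr; apply: ler_wsqrtr; rewrite lerDr sqr_ge0.
Qed.

Lemma normcE_norm (z : R[i]) : `|z| = (normc z)%:C%C.
Proof. by case: z. Qed.

Lemma Re_le_normc (z : R[i]) : `|complex.Re z| <= normc z.
Proof. by rewrite -lecR -normcE_norm normc_ge_Re. Qed.

Lemma Im_le_normc (z : R[i]) : `|complex.Im z| <= normc z.
Proof. by rewrite -lecR -normcE_norm normc_ge_Im. Qed.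

Lemma normcD (z t : R[i]) : normc (z + t) <= normc z + normc t.
Proof. by rewrite -lecR rmorphD -!normcE_norm; exact: ler_normD. Qed.

Lemma normc_ge0 (z : R[i]) : 0 <= normc z.
Proof. by rewrite -lecR -normcE_norm normr_ge0. Qed.

(** The modulus lies between the maximum and the sum of the moduli of the two
    parts, so everything about complex limits reduces to real ones. *)
Lemma cvg_complexP (T : Type) (F : set_system T) (FF : Filter F)
    (f : T -> R[i]) (l : R[i]) :
  (f : T -> R[i]^o) x @[x --> F] --> (l : R[i]^o) <->
  complex.Re (f x) @[x --> F] --> complex.Re l /\
  complex.Im (f x) @[x --> F] --> complex.Im l.
Proof.
split=> [/cvgrPdist_lt fl|[/cvgrPdist_lt fRe /cvgrPdist_lt fIm]].
  split; apply/cvgrPdist_lt => e e0.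
    have e0' : 0 < e%:C%C by rewrite ltcR.
    apply: filterS (fl _ e0') => x; rewrite -ltcR; apply: le_lt_trans.
    by rewrite -raddfB; exact: normc_ge_Re.
  have e0' : 0 < e%:C%C by rewrite ltcR.
  apply: filterS (fl _ e0') => x; rewrite -ltcR; apply: le_lt_trans.
  by rewrite -raddfB; exact: normc_ge_Im.
(* A radius is a positive element of R[i], so its imaginary part vanishes. *)
apply/cvgrPdist_lt => -[e e'] /=; rewrite ltcE /= => /andP[/eqP -> e0].
have e2 : 0 < e / 2 by rewrite divr_gt0.
apply: filterS2 (fRe _ e2) (fIm _ e2) => x xRe xIm.
apply: le_lt_trans (normc_le_ReIm _) _.
by rewrite ltcR [ltRHS]splitr !raddfB ltrD.
Qed.

End complex_limits.

Lemma normc_unity_root (R : realType) (m : nat) (z : R[i]) :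
  (0 < m)%N -> z ^+ m = 1 -> ComplexField.Normc.normc z = 1.
Proof.
move=> m_gt0 zm; have : `|z| ^+ m == 1 by rewrite -normrX zm normr1.
by rewrite pexpr_eq1// normcE_norm => /eqP[].
Qed.

Section complex_measurable.
Context d (T : measurableType d) (R : realType).

Definition cmeasurable (f : T -> R[i]) : Prop :=
  measurable_fun setT (fun x => complex.Re (f x)) /\
  measurable_fun setT (fun x => complex.Im (f x)).

Lemma cmeasurable_cst c : cmeasurable (fun=> c).
Proof. by split; exact: measurable_cst. Qed.

Lemma cmeasurable_indic (U : set T) : measurable U -> cmeasurable \1_U.
Proof.
move=> mU; split; last first.
  rewrite (_ : (fun _ => _) = cst 0); first exact: measurable_cst.
  by apply/funext => x; rewrite indicE; case: (_ \in _).
rewrite (_ : (fun _ => _) = \1_U); first exact: measurable_indic.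
by apply/funext => x; rewrite !indicE; case: (_ \in _).
Qed.

Lemma cmeasurableD f g : cmeasurable f -> cmeasurable g ->
  cmeasurable (fun x => f x + g x).
Proof.
move=> [fr fi] [gr gi]; split.
  by under eq_fun do rewrite raddfD; exact: measurable_funD.
by under eq_fun do rewrite raddfD; exact: measurable_funD.
Qed.

Lemma cmeasurableM f g : cmeasurable f -> cmeasurable g ->
  cmeasurable (fun x => f x * g x).
Proof.
move=> [fr fi] [gr gi]; split.
  under eq_fun do rewrite ReM.
  by apply: measurable_funB; exact: measurable_funM.
under eq_fun do rewrite ImM.
by apply: measurable_funD; exact: measurable_funM.
Qed.

Lemma cmeasurableX f n : cmeasurable f -> cmeasurable (fun x => f x ^+ n).
Proof.
move=> mf; elim: n => [|n IH]; first exact: cmeasurable_cst.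
by under eq_fun do rewrite exprS; exact: cmeasurableM.
Qed.

Lemma cmeasurable_sum (I : Type) (s : seq I) (f : I -> T -> R[i]) :
  (forall i, cmeasurable (f i)) -> cmeasurable (fun x => \sum_(i <- s) f i x).
Proof.
move=> mf; elim: s => [|i s IH].
  by under eq_fun do rewrite big_nil; exact: cmeasurable_cst.
by under eq_fun do rewrite big_cons; exact: cmeasurableD.
Qed.

Lemma measurable_fiber f z : cmeasurable f -> measurable [set x | f x = z].
Proof.
move=> [mRe mIm].
rewrite (_ : [set _ | _] =
    (fun x => complex.Re (f x)) @^-1` [set complex.Re z] `&`
    (fun x => complex.Im (f x)) @^-1` [set complex.Im z]).
  apply: measurableI; rewrite -[X in measurable X]setTI.
    exact: mRe.
  exact: mIm.
apply/seteqP; split=> x /=; first by move=> ->.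
by case: (f x) z {mRe mIm} => [a b] [a' b'] /= [-> ->].
Qed.

(** The Cauchy criterion with countable quantifiers only, in view of the next
    lemma. *)
Lemma cvgn_cauchyP (u : R^nat) : cvgn u <->
  forall k, exists N, forall n, (N <= n)%N -> `|u N - u n| < k.+1%:R^-1.
Proof.
split=> [/cvg_ex[l /cvgrPdist_lt ul] k|uc].
  have e0 : 0 < k.+1%:R^-1 / 2 :> R by rewrite divr_gt0.
  have [N _ Nl] := ul _ e0; exists N => n Nn.
  rewrite (splitr k.+1%:R^-1) -(subrKA l) (le_lt_trans (ler_normD _ _))//.
  by rewrite ltrD// ?[`|l - _|]distrC ?Nl//= distrC Nl /=.
apply/cauchy_cvgP/cauchy_exP => e e0.
have [k ke] := ltr_add_invr (y := 0) (x := e) e0.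
have [N uN] := uc k; exists (u N), N => // n /= /uN.
rewrite /ball /= => /lt_trans; apply; by rewrite add0r in ke.
Qed.

Lemma measurable_cvgn (h : nat -> T -> R) :
  (forall n, measurable_fun setT (h n)) -> measurable [set x | cvgn (h ^~ x)].
Proof.
move=> mh.
rewrite (_ : [set _ | _] =
    \bigcap_k \bigcup_N \bigcap_(n in [set n | (N <= n)%N])
      [set x | `|h N x - h n x| < k.+1%:R^-1]).
  apply: bigcapT_measurable => k; apply: bigcupT_measurable => N.
  apply: bigcap_measurable => [|n _]; first by exists N => /=.
  have := measurableT_comp (@normr_measurable R setT)
    (measurable_funB (mh N) (mh n)).
  move=> /(_ measurableT `]-oo, k.+1%:R^-1[%classic) /(_ (measurable_itv _)).
  rewrite setTI [X in _ -> measurable X](_ : _ =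
    (fun x => `|h N x - h n x|) @^-1` `]-oo, k.+1%:R^-1[)//.
apply/seteqP; split=> x.
  by move=> /cvgn_cauchyP xc k _; have [N xN] := xc k; exists N.
move=> xc; apply/cvgn_cauchyP => k; have [N _ xN] := xc k I.
by exists N => n Nn; exact: xN.
Qed.

(** Divergence causes no trouble: [limn] is constant, equal to a default value,
    on the measurable set where the sequence diverges.  This gives measurability
    of gtilde on the whole group, with no completion of the measure. *)
Lemma cmeasurable_limn (f : nat -> T -> R[i]) :
  (forall n, cmeasurable (f n)) ->
  cmeasurable (fun x => limn ((fun n => f n x) : (R[i]^o)^nat)).
Proof.
move=> mf.
pose C := [set x | cvgn (fun n => complex.Re (f n x))] `&`
          [set x | cvgn (fun n => complex.Im (f n x))].
have mC : measurable C.
  by apply: measurableI; apply: measurable_cvgn => n; have [] := mf n.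
have Clim x : C x -> (f n x : R[i]^o) @[n --> \oo] -->
    (limn ((fun n => f n x) : (R[i]^o)^nat) : R[i]^o).
  move=> [/cvg_ex[a xa] /cvg_ex[b xb]]; apply/cvg_ex; exists (Complex a b).
  exact/cvg_complexP.
have Dlim x : ~ C x -> limn ((fun n => f n x) : (R[i]^o)^nat) = point.
  move=> nCx; apply/dvgP => /cvg_ex[l /cvg_complexP[xa xb]]; apply: nCx.
  by split; apply/cvg_ex; eexists; eassumption.
have CNC : setT = C `|` ~` C by rewrite setUCr.
have mNC := measurableC mC.
split; rewrite CNC; apply/(measurable_funU _ mC mNC); split.
- apply: (@measurable_fun_cvg _ _ _ _ (fun n x => complex.Re (f n x))).
    by move=> n; apply: measurable_funTS; case: (mf n).
  by move=> x /Clim/cvg_complexP[].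
- apply: (eq_measurable_fun (cst (complex.Re (point : R[i]^o)))) => //.
  by move=> x; rewrite inE => /Dlim ->.
- apply: (@measurable_fun_cvg _ _ _ _ (fun n x => complex.Im (f n x))).
    by move=> n; apply: measurable_funTS; case: (mf n).
  by move=> x /Clim/cvg_complexP[].
- apply: (eq_measurable_fun (cst (complex.Im (point : R[i]^o)))) => //.
  by move=> x; rewrite inE => /Dlim ->.
Qed.

End complex_measurable.

Lemma cmeasurable_continuous (R : realType) (A : invsystem)
    (f : invlim A -> R[i]) :
  continuous (f : invlim A -> R[i]^o) -> cmeasurable (f : borelType A -> R[i]).
Proof.
move=> fc; split; apply: continuous_measurable_invlim => x.
  by have /cvg_complexP[] := fc x.
by have /cvg_complexP[] := fc x.
Qed.

(** * Integrals of complex functions *)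

Section complex_integral_theory.
Context d (T : measurableType d) (R : realType).
Variable mu : {measure set T -> \bar R}.
Local Notation normc := (@ComplexField.Normc.normc R).

Lemma cintegrable_dominated (f : T -> R[i]) (h : T -> \bar R) :
  cmeasurable f -> mu.-integrable setT h ->
  (forall x, ((normc (f x))%:E <= h x)%E) -> cintegrable mu f.
Proof.
move=> [mRe mIm] ih fh; split.
  apply: (le_integrable measurableT _ _ ih); first exact/measurable_EFinP.
  move=> x _; rewrite abse_EFin.
  rewrite (le_trans _ (lee_abs _))// (le_trans _ (fh x))//.
  by rewrite lee_fin Re_le_normc.
apply: (le_integrable measurableT _ _ ih); first exact/measurable_EFinP.
move=> x _; rewrite abse_EFin (le_trans _ (lee_abs _))// (le_trans _ (fh x))//.
by rewrite lee_fin Im_le_normc.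
Qed.

Lemma Rdominated_convergence (f_ : nat -> T -> R) (f : T -> R)
    (h : T -> \bar R) :
  (forall n, measurable_fun setT (f_ n)) -> measurable_fun setT f ->
  {ae mu, forall x, f_ n x @[n --> \oo] --> f x} ->
  mu.-integrable setT h -> (forall n x, (`|f_ n x|%:E <= h x)%E) ->
  mu.-integrable setT (EFin \o f) /\
  Rintegral mu setT (f_ n) @[n --> \oo] --> Rintegral mu setT f.
Proof.
move=> mf_ mf f_f ih f_h.
have [] := @dominated_convergence _ _ _ mu setT measurableT
  (fun n x => (f_ n x)%:E) (EFin \o f) h.
- by move=> n; exact/measurable_EFinP.
- exact/measurable_EFinP.
- by apply: filterS f_f => x f_fx _; apply: cvg_EFin; first exact: nearW.
- exact: ih.
- by apply: aeW => x n _; rewrite abse_EFin.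
move=> intf _ cvgf; split=> //; apply: fine_cvg.
by rewrite fineK //; exact: integrable_fin_num.
Qed.

Lemma cdominated_convergence (f_ : nat -> T -> R[i]) (f : T -> R[i])
    (h : T -> \bar R) :
  (forall n, cmeasurable (f_ n)) -> cmeasurable f ->
  {ae mu, forall x, (f_ n x : R[i]^o) @[n --> \oo] --> (f x : R[i]^o)} ->
  mu.-integrable setT h -> (forall n x, ((normc (f_ n x))%:E <= h x)%E) ->
  cintegrable mu f /\
  (cintegral mu (f_ n) : R[i]^o) @[n --> \oo] --> (cintegral mu f : R[i]^o).
Proof.
move=> mf_ [mRe mIm] f_f ih f_h.
have [] := @Rdominated_convergence (fun n x => complex.Re (f_ n x))
  (fun x => complex.Re (f x)) h _ _ _ ih.
- by move=> n; have [] := mf_ n.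
- by [].
- by apply: filterS f_f => x /cvg_complexP[].
- by move=> n x; apply: le_trans (f_h n x); rewrite lee_fin Re_le_normc.
move=> iRe cRe.
have [] := @Rdominated_convergence (fun n x => complex.Im (f_ n x))
  (fun x => complex.Im (f x)) h _ _ _ ih.
- by move=> n; have [] := mf_ n.
- by [].
- by apply: filterS f_f => x /cvg_complexP[].
- by move=> n x; apply: le_trans (f_h n x); rewrite lee_fin Im_le_normc.
by move=> iIm cIm; split=> //; exact/cvg_complexP.
Qed.

Lemma cintegrableD (f g : T -> R[i]) : cintegrable mu f -> cintegrable mu g ->
  cintegrable mu (fun x => f x + g x).
Proof.
move=> [fr fi] [gr gi]; split.
  by under eq_fun do rewrite raddfD EFinD; exact: integrableD.
by under eq_fun do rewrite raddfD EFinD; exact: integrableD.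
Qed.

Lemma cintegralD (f g : T -> R[i]) : cintegrable mu f -> cintegrable mu g ->
  cintegral mu (fun x => f x + g x) = cintegral mu f + cintegral mu g.
Proof.
move=> [fr fi] [gr gi]; apply: (congr2 (@Complex R)).
  rewrite -(@RintegralD _ _ _ mu)//.
  by apply: eq_Rintegral => x _; rewrite raddfD.
rewrite -(@RintegralD _ _ _ mu)//.
by apply: eq_Rintegral => x _; rewrite raddfD.
Qed.

Lemma cintegral_sum (I : Type) (s : seq I) (f : I -> T -> R[i]) :
  (forall i, cintegrable mu (f i)) ->
  cintegrable mu (fun x => \sum_(i <- s) f i x) /\
  cintegral mu (fun x => \sum_(i <- s) f i x) =
    \sum_(i <- s) cintegral mu (f i).
Proof.
move=> fi; elim: s => [|i s [IH1 IH2]].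
  under eq_fun do rewrite big_nil.
  rewrite big_nil; split.
    by split; exact: integrable0.
  by rewrite /cintegral /= Rintegral_cst// mul0r.
under eq_fun do rewrite big_cons.
by rewrite big_cons cintegralD// IH2; split=> //; exact: cintegrableD.
Qed.

End complex_integral_theory.

Lemma cintegral_indic d (T : measurableType d) (R : realType)
    (mu : {finite_measure set T -> \bar R}) (c : R[i]) (E : set T) :
  measurable E ->
  cintegrable mu (fun x => c * \1_E x) /\
  cintegral mu (fun x => c * \1_E x) = c * (fine (mu E))%:C%C.
Proof.
move=> mE.
have ReE x : complex.Re (c * \1_E x) = complex.Re c * \1_E x.
  by rewrite ReM !indicE; case: (_ \in _); rewrite /= ?(mulr0, mulr1, subr0).
have ImE x : complex.Im (c * \1_E x) = complex.Im c * \1_E x.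
  by rewrite ImM !indicE; case: (_ \in _); rewrite /= ?(mulr0, mulr1, add0r).
have iE : mu.-integrable setT (EFin \o (\1_E : T -> R)).
  exact: integrable_indic.
have iEr (r : R) : mu.-integrable setT (fun x => (r * \1_E x)%:E).
  exact: integrableZl iE.
have cE (r : R) : \int[mu]_(x in setT) (r * \1_E x) = r * fine (mu E).
  by rewrite RintegralZl// /Rintegral integral_indic// setIT.
split.
  by split; [under eq_fun do rewrite ReE|under eq_fun do rewrite ImE].
rewrite /cintegral; under eq_Rintegral do rewrite ReE.
rewrite cE; under eq_Rintegral do rewrite ImE.
rewrite cE; case: c {ReE ImE} => a b /=.
by simpc.
Qed.

(** * Series of indicators with summable measures *)

Section summable_indicators.
Context d (T : measurableType d) (R : realType).
Variable mu : {finite_measure set T -> \bar R}.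
Local Notation normc := (@ComplexField.Normc.normc R).
Variables (c : nat -> R[i]) (E : nat -> set T).
Hypothesis mE : forall k, measurable (E k).

Definition indic_series (x : T) : R[i]^o ^nat :=
  series (fun k => c k * \1_(E k) x).

(** Valued in the extended reals, the majorant is defined also at the points
    where the series does not converge absolutely. *)
Definition indic_majorant (x : T) : \bar R :=
  (\sum_(0 <= k <oo) (normc (c k) * \1_(E k) x)%:E)%E.

Lemma normc_indic (z : R[i]) (U : set T) x :
  normc (z * \1_U x) = normc z * \1_U x.
Proof.
rewrite !indicE; case: (x \in U); first by rewrite !mulr1.
by rewrite !mulr0 ComplexField.Normc.normc0.
Qed.

Lemma indic_majorant_ge0 k x : (0 <= (normc (c k) * \1_(E k) x)%:E)%E.
Proof. by rewrite lee_fin mulr_ge0 // normc_ge0. Qed.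

Lemma indic_series_le x n :
  ((normc (indic_series x n))%:E <= indic_majorant x)%E.
Proof.
apply: le_trans (nneseries_lim_ge n _); last first.
  by move=> k _ _; exact: indic_majorant_ge0.
rewrite sumEFin lee_fin /indic_series /series /=.
elim/big_ind2: _ => [|z1 r1 z2 r2 h1 h2|k _].
- by rewrite ComplexField.Normc.normc0.
- exact: le_trans (normcD _ _) (lerD h1 h2).
- by rewrite normc_indic.
Qed.

Lemma cmeasurable_indic_series n : cmeasurable (fun x => indic_series x n).
Proof.
apply: cmeasurable_sum => k; apply: cmeasurableM; first exact: cmeasurable_cst.
exact: cmeasurable_indic.
Qed.

Hypothesis summable : (\sum_(0 <= k <oo) (normc (c k))%:E * mu (E k) < +oo)%E.

(** By monotone convergence the integral of the majorant is the sum of the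
    |c k| mu (E k). *)
Lemma integrable_indic_majorant : mu.-integrable setT indic_majorant.
Proof.
have mF k : measurable_fun setT (fun x => (normc (c k) * \1_(E k) x)%:E).
  apply/measurable_EFinP/measurable_funM; first exact: measurable_cst.
  exact: measurable_indic.
apply/integrableP; split.
  by apply: ge0_emeasurable_sum => // k x _ _; exact: indic_majorant_ge0.
apply: le_lt_trans summable.
rewrite (eq_integral indic_majorant); last first.
  move=> x _; rewrite gee0_abs// nneseries_ge0// => k _ _.
  exact: indic_majorant_ge0.
rewrite integral_nneseries//; last by move=> k x _; exact: indic_majorant_ge0.
apply: lee_nneseries => [k _ _|k _].
  by apply: integral_ge0 => x _; exact: indic_majorant_ge0.
under eq_integral do rewrite EFinM.
rewrite ge0_integralZl_EFin//; first by rewrite integral_indic// setIT.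
- apply/measurable_EFinP; exact: measurable_indic.
- exact: normc_ge0.
Qed.

(** An integrable function is finite almost everywhere, and where the majorant
    is finite the series converges absolutely. *)
Lemma indic_series_cvg : {ae mu, forall x, cvgn (indic_series x)}.
Proof.
apply: filterS (integrable_ae measurableT integrable_indic_majorant).
move=> x /(_ I) finx.
have cvgN : cvgn (series (fun k => normc (c k * \1_(E k) x))).
  apply: nondecreasing_is_cvgn.
    by apply/nondecreasing_series => k _ _; exact: normc_ge0.
  exists (fine (indic_majorant x)) => _ [n _ <-].
  rewrite -lee_fin fineK //.
  apply: le_trans (nneseries_lim_ge n _); last first.
    by move=> k _ _; exact: indic_majorant_ge0.
  rewrite sumEFin lee_fin /series /=.
  by apply: ler_sum => k _; rewrite normc_indic.
have /cvg_ex[a xa] : cvgn (series (fun k => complex.Re (c k * \1_(E k) x))).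
  apply: normed_cvg; apply: series_le_cvg cvgN => k //=.
    exact: normc_ge0.
  exact: Re_le_normc.
have /cvg_ex[b xb] : cvgn (series (fun k => complex.Im (c k * \1_(E k) x))).
  apply: normed_cvg; apply: series_le_cvg cvgN => k //=.
    exact: normc_ge0.
  exact: Im_le_normc.
apply/cvg_ex; exists (Complex a b); apply/cvg_complexP.
rewrite /indic_series /series; split.
  by under eq_fun do rewrite raddf_sum; exact: xa.
by under eq_fun do rewrite raddf_sum; exact: xb.
Qed.

(** The partial sums times w are bounded by the integrable majorant.  The factor
    w stands for the powers of a unitary character. *)
Lemma cintegral_indic_series (w : T -> R[i]) :
  cmeasurable w -> (forall x, normc (w x) <= 1) ->
  [/\ forall n, cintegrable mu (fun x => indic_series x n * w x),
      cintegrable mu (fun x => limn (indic_series x) * w x) &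
      (cintegral mu (fun x => indic_series x n * w x) : R[i]^o) @[n --> \oo] -->
      (cintegral mu (fun x => limn (indic_series x) * w x) : R[i]^o)].
Proof.
move=> mw w1.
have mS n : cmeasurable (fun x => indic_series x n * w x).
  by apply: cmeasurableM => //; exact: cmeasurable_indic_series.
have leS n x : ((normc (indic_series x n * w x))%:E <= indic_majorant x)%E.
  apply: le_trans (indic_series_le x n).
  by rewrite lee_fin ComplexField.Normc.normcM ler_piMr // normc_ge0.
have [] := cdominated_convergence (mu := mu) mS
  (f := fun x => limn (indic_series x) * w x) (h := indic_majorant).
- apply: cmeasurableM => //; apply: cmeasurable_limn.
  exact: cmeasurable_indic_series.
- apply: filterS indic_series_cvg => x xc.
  apply: cvgM; first exact: xc.
  exact: cvg_cst.
- exact: integrable_indic_majorant.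
- exact: leS.
move=> il cl; split => // n.
by apply: cintegrable_dominated integrable_indic_majorant _.
Qed.

End summable_indicators.

(** * The integral formula *)

Theorem theorem1p6 (R : realType) (G A : invsystem)
    (G_surj : surjective_system G) (A_surj : surjective_system A)
    (rn : forall n : posnat, {multiplicative G n -> A n})
    (rn_inj : forall n : posnat, injective (rn n))
    (rn_compat : compatible rn)
    (m : nat) (m_gt0 : (0 < m)%N)
    (chi : invlim A -> R[i])
    (chiM : forall a b : invlim A, chi (a * b)%g = chi a * chi b)
    (chi_cont : continuous (chi : invlim A -> R[i]^o))
    (exact_seq : short_exact m (limit_map rn_compat) chi)
    (g : posnat -> R[i])
    (g_sum : cvgn (series (fun k =>
       ComplexField.Normc.normc (g (pos k)) / #|G (pos k)|%:R : R)))
    (nu : probability (borelType A) R) (nu_haar : normalized_haar nu) :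
  [/\ {ae nu, forall a : borelType A, cvgn (gtilde_series g a)},
      cintegrable nu (gtilde g : borelType A -> R[i])
    & series (fun k => g (pos k) / #|G (pos k)|%:R : R[i]^o) @ \oo -->
      (\sum_(i < m) cintegral nu
         (fun a : borelType A => gtilde g a * chi a ^+ i) : R[i]^o)].
Proof.
have mchi : cmeasurable (chi : borelType A -> R[i]).
  exact: cmeasurable_continuous.
have mK : measurable ([set a | chi a = 1] : set (borelType A)).
  exact: (measurable_fiber 1 mchi).
have chi_root a : chi a ^+ m = 1.
  have [_ _ chi_range] := exact_seq; have : range chi (chi a) by exists a.
  by rewrite chi_range => /unity_rootP.
pose ker k : set (borelType A) := proj_ker A (pos k).
have mker k : measurable (ker k) by exact: measurable_proj_ker.
have le_card n : (#|G n| <= #|A n|)%N := leq_card _ (rn_inj n).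
have obj_gt0 (S : invsystem) n : (0 < #|S n|)%N by apply/card_gt0P; exists 1%g.
pose normc := @ComplexField.Normc.normc R.
(* nu (ker k) = 1 / #|A (pos k)| is at most 1 / #|G (pos k)|, so the assumption
   on g bounds this sum. *)
have g_sumA : (\sum_(0 <= k <oo) (normc (g (pos k)))%:E * nu (ker k) < +oo)%E.
  apply: (@le_lt_trans _ _ (limn (EFin \o series (fun k =>
      normc (g (pos k)) / #|G (pos k)|%:R)))); last first.
    by rewrite EFin_lim// ltry.
  rewrite (_ : EFin \o _ = fun n =>
      (\sum_(0 <= k < n)
         (normc (g (pos k)) / #|G (pos k)|%:R)%:E)%E); last first.
    by apply/funext => n /=; rewrite sumEFin.
  apply: lee_nneseries => [k _ _|k _].
    by rewrite mule_ge0// lee_fin normc_ge0.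
  rewrite /ker haar_proj_ker// -EFinM lee_fin ler_wpM2l ?normc_ge0//.
  by rewrite lef_pV2 ?posrE ?ltr0n// ler_nat.
have ker_chi k :
    nu (ker k `&` [set a | chi a = 1]) = ((m * #|G (pos k)|)%:R^-1)%:E.
  exact: (haar_proj_ker_exact G_surj nu_haar rn_inj m_gt0 chiM exact_seq mK).
have int_chi (i : nat) : [/\ forall n, cintegrable nu
        (fun a : borelType A => gtilde_series g a n * chi a ^+ i),
      cintegrable nu (fun a : borelType A => gtilde g a * chi a ^+ i) &
      (cintegral nu (fun a : borelType A =>
         gtilde_series g a n * chi a ^+ i) : R[i]^o) @[n --> \oo] -->
      (cintegral nu (fun a : borelType A => gtilde g a * chi a ^+ i) : R[i]^o)].
  apply: (cintegral_indic_series mker g_sumA (cmeasurableX i mchi)) => a.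
  suff -> : ComplexField.Normc.normc (chi a ^+ i) = 1 by [].
  by apply: (@normc_unity_root _ m); rewrite // exprAC chi_root expr1n.
split.
- exact: (indic_series_cvg mker g_sumA).
(* gtilde itself is the case of the trivial power of chi. *)
- have [_ + _] := int_chi 0%N.
  by congr cintegrable; apply/funext => a; rewrite expr0 mulr1.
(* Only finite sums are exchanged here; int_chi takes care of the limit. *)
have sum_int n :
    \sum_(i < m) cintegral nu
      (fun a : borelType A => gtilde_series g a n * chi a ^+ i) =
    series (fun k => g (pos k) / #|G (pos k)|%:R : R[i]^o) n.
  have int_n (i : 'I_m) : cintegrable nu
      (fun a : borelType A => gtilde_series g a n * chi a ^+ i).
    by have [] := int_chi i.
  rewrite -(cintegral_sum _ int_n).2.
  rewrite (_ : (fun _ => _) = fun a : borelType A => \sum_(0 <= k < n)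
      g (pos k) * m%:R * \1_(ker k `&` [set a | chi a = 1]) a); last first.
    apply/funext => a; rewrite -mulr_sumr sum_unity_root//.
    rewrite /gtilde_series /series /= mulr_suml; apply: eq_bigr => k _.
    rewrite indicI /= mulrACA -!mulrA; congr (_ * _); congr (_ * (_ * _)).
    rewrite indicE; congr (_%:R); congr nat_of_bool.
    by apply/eqP/idP => [ca|/set_mem//]; exact/mem_set.
  have int_k k : cintegrable nu (fun a : borelType A =>
        g (pos k) * m%:R * \1_(ker k `&` [set a | chi a = 1]) a) /\
      cintegral nu (fun a : borelType A =>
        g (pos k) * m%:R * \1_(ker k `&` [set a | chi a = 1]) a) =
      g (pos k) / #|G (pos k)|%:R.
    have [? ->] := cintegral_indic nu (g (pos k) * m%:R)
      (measurableI _ _ (mker k) mK).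
    split=> //; rewrite -mulrA; congr (_ * _).
    transitivity (m%:R * ((m * #|G (pos k)|)%:R^-1 : R)%:C%C).
      by rewrite -[(m * _)%:R^-1]/(fine (_%:E)) -ker_chi.
    rewrite natrM invfM rmorphM !fmorphV !rmorph_nat mulrA mulfV ?mul1r//.
    by rewrite pnatr_eq0 -lt0n.
  rewrite (cintegral_sum _ (fun k => (int_k k).1)).2.
  by apply: eq_bigr => k _; rewrite (int_k k).2.
rewrite (_ : series _ = fun n => \sum_(i < m) cintegral nu
    (fun a : borelType A => gtilde_series g a n * chi a ^+ i)); last first.
  by apply/funext => n; rewrite sum_int.
by apply: cvg_big => [|i _]; [exact: add_continuous|have [] := int_chi i].
Qed.
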